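(* Let $X$ be a Bishop topological group with Bishop topology $F$, and let $H$ be a subgroup of $X$. (i) The closure $\overline{H}$ of $H$ is also a subgroup of $X$. (ii) If $F$ is a separating Bishop topology and $H$ is abelian, then $\overline{H}$ is abelian. (iii) If $H$ is normal, then $\overline{H}$ is normal.
   Context: The setting is Bishop-style constructive mathematics (BISH: intuitionistic logic, every set $X$ carries a given equality $=_X$, no countable choice). $\mathbb{F}(X)$ is the set of functions $X \to \mathbb{R}$ with pointwise equality. $\mathrm{Bic}(\mathbb{R})$ is the set of functions $\phi : \mathbb{R} \to \mathbb{R}$ that are uniformly continuous on every interval $[-n,n]$, $n \geq 1$. A Bishop space is a pair $(X,F)$, where $X$ is an inhabited set and $F \subseteq \mathbb{F}(X)$ is extensional (if $f \in F$ and $g$ is pointwise equal to $f$, then $g \in F$) such that: (BS1) all constant functions are in $F$; (BS2) $f, g \in F$ implies $f+g \in F$; (BS3) $f \in F$ and $\phi \in \mathrm{Bic}(\mathbb{R})$ imply $\phi \circ f \in F$; (BS4) if $f \in \mathbb{F}(X)$ and for every $\varepsilon > 0$ there is $g \in F$ with $|g(x) - f(x)| \leq \varepsilon$ for all $x \in X$, then $f \in F$. Then $F$ is called a Bishop topology on $X$. A Bishop morphism from $(X,F)$ to $(Y,G)$ is a function $h : X \to Y$ with $g \circ h \in F$ for every $g \in G$. The product topology $F \times G$ on $X \times Y$ is the least Bishop topology (inductively generated by the closure conditions (BS1)-(BS4) and extensionality) containing all $f \circ \pi_1$, $f \in F$, and all $g \circ \pi_2$, $g \in G$, where $\pi_1,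 \pi_2$ are the projections. A Bishop topological group is a (not necessarily abelian, additively written) group $(X,+,0,-)$ with a Bishop topology $F$ on $X$ such that $+ : X \times X \to X$ is a Bishop morphism from $(X \times X, F \times F)$ to $(X,F)$ and $- : X \to X$ is a Bishop morphism from $(X,F)$ to $(X,F)$. For $H \subseteq X$, the closure $\overline{H}$ consists of all $x \in X$ such that for every $f \in F$, if $f(x) > 0$ then there is $v \in H$ with $f(v) > 0$. $F$ is separating (separates the points of $X$) if for all $x, y \in X$: if $f(x) = f(y)$ for every $f \in F$, then $x =_X y$. *)

(* Defs.v *)
From Stdlib Require Import QArith Setoid Morphisms.
From Stdlib Require Export ConstructiveCauchyReals ConstructiveCauchyAbs.

Set Implicit Arguments.
Unset Strict Implicit.

Open Scope CReal_scope.

(** Bishop sets are setoids and functions between them are setoid morphisms.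
    The real numbers are the Cauchy reals [CReal] with modulus, with [CRealEq]
    as their equality.  Existence is [exists] in [Prop], which yields no choice
    function.  [CRealLtProp] is the [Prop]-valued strict order, equivalent to the
    [Set]-valued [<] by [CRealLtForget] and [CRealLtEpsilon]. *)

Record bset := BSet {
  bcar :> Type;
  beq : bcar -> bcar -> Prop;
  beq_equiv : Equivalence beq
}.

#[export] Existing Instance beq_equiv.

Declare Scope bset_scope.
Delimit Scope bset_scope with bset.
Infix "==" := (@beq _) : bset_scope.

Record bfun (X Y : bset) := BFun {
  bapp :> X -> Y;
  bapp_ext : Proper (@beq X ==> @beq Y) bapp
}.

#[export] Existing Instance bapp_ext.

Lemma CRealEq_equivalence : Equivalence CRealEq.
Proof.
split; [exact CRealEq_refl | exact CRealEq_sym | exact CRealEq_trans].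
Qed.

Definition Rset : bset := BSet CRealEq_equivalence.

Definition beq_prod (X Y : bset) (p q : X * Y) : Prop :=
  (fst p == fst q)%bset /\ (snd p == snd q)%bset.

Lemma beq_prod_equivalence (X Y : bset) : Equivalence (@beq_prod X Y).
Proof.
split.
- intros p; split; reflexivity.
- intros p q [H1 H2]; split; symmetry; assumption.
- intros p q r [H1 H2] [H3 H4]; split; etransitivity; eassumption.
Qed.

Definition bprod (X Y : bset) : bset := BSet (beq_prod_equivalence X Y).

Program Definition bfst (X Y : bset) : bfun (bprod X Y) X := @BFun _ _ fst _.
Next Obligation. intros p q [H _]; exact H. Qed.

Program Definition bsnd (X Y : bset) : bfun (bprod X Y) Y := @BFun _ _ snd _.
Next Obligation. intros p q [_ H]; exact H. Qed.

Program Definition bcomp (X Y Z : bset) (g : bfun Y Z) (f : bfun X Y) : bfun X Z :=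
  @BFun _ _ (fun x => g (f x)) _.
Next Obligation. intros x y H; rewrite H; reflexivity. Qed.

Program Definition bconst (X : bset) (a : CReal) : bfun X Rset :=
  @BFun X Rset (fun _ => a) _.
Next Obligation. intros x y _; reflexivity. Qed.

Program Definition bplus (X : bset) (f g : bfun X Rset) : bfun X Rset :=
  @BFun X Rset (fun x => (f x : CReal) + (g x : CReal)) _.
Next Obligation.
intros x y H; apply CReal_plus_morph; [exact (bapp_ext f H) | exact (bapp_ext g H)].
Qed.

Definition feq (X : bset) (f g : bfun X Rset) : Prop := forall x, (f x == g x)%bset.

Definition Bic (phi : bfun Rset Rset) : Prop :=
  forall n : nat, (1 <= n)%nat ->
  let N := inject_Z (Z.of_nat n) in
  forall eps : CReal, CRealLtProp 0 eps ->
  exists delta : CReal, CRealLtProp 0 delta /\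
    forall x y : CReal, - N <= x <= N -> - N <= y <= N ->
      CReal_abs (x - y) <= delta -> CReal_abs (phi x - phi y) <= eps.

Definition within (X : bset) (g f : bfun X Rset) (eps : CReal) : Prop :=
  forall x, CReal_abs (g x - f x) <= eps.

Record is_bishop_topology (X : bset) (F : bfun X Rset -> Prop) : Prop := {
  top_ext : forall f g, F f -> feq f g -> F g;
  top_const : forall a, F (bconst X a);
  top_plus : forall f g, F f -> F g -> F (bplus f g);
  top_bic : forall f phi, F f -> Bic phi -> F (bcomp phi f);
  top_lim : forall f,
    (forall eps, CRealLtProp 0 eps -> exists g, F g /\ within g f eps) -> F f
}.

Record bishop_space := BishopSpace {
  space_set :> bset;
  space_inhabited : inhabited space_set;
  top : bfun space_set Rset -> Prop;
  top_is_topology : is_bishop_topology top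
}.

Arguments top : clear implicits.

Definition bishop_morphism (X Y : bishop_space) (h : bfun X Y) : Prop :=
  forall g, top Y g -> top X (bcomp g h).

Inductive generated_topology (X : bset) (S : bfun X Rset -> Prop) :
    bfun X Rset -> Prop :=
| gen_base : forall f, S f -> generated_topology S f
| gen_ext : forall f g,
    generated_topology S f -> feq f g -> generated_topology S g
| gen_const : forall a, generated_topology S (bconst X a)
| gen_plus : forall f g,
    generated_topology S f -> generated_topology S g ->
    generated_topology S (bplus f g)
| gen_bic : forall f phi,
    generated_topology S f -> Bic phi -> generated_topology S (bcomp phi f)
| gen_lim : forall f,
    (forall eps, CRealLtProp 0 eps ->
       exists g, generated_topology S g /\ within g f eps) ->
    generated_topology S f.

Lemma generated_topology_is_topology (X : bset) (S : bfun X Rset -> Prop) :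
  is_bishop_topology (generated_topology S).
Proof.
split.
- exact (@gen_ext X S).
- exact (@gen_const X S).
- exact (@gen_plus X S).
- exact (@gen_bic X S).
- exact (@gen_lim X S).
Qed.

(** Because of the nested existential in [gen_lim], the automatically generated
    induction principle has no induction hypothesis in that case; this lemma is
    the usable one. *)
Lemma generated_topology_least (X : bset) (S F : bfun X Rset -> Prop) :
  is_bishop_topology F -> (forall f, S f -> F f) ->
  forall f, generated_topology S f -> F f.
Proof.
intros HF HS.
fix IH 2; intros f [g Hg | g k Hg Hk | a | g k Hg Hk | g phi Hg Hphi | g Hg].
- exact (HS g Hg).
- exact (top_ext HF (IH g Hg) Hk).
- exact (top_const HF a).
- exact (top_plus HF (IH g Hg) (IH k Hk)).
- exact (top_bic HF (IH g Hg) Hphi).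
- apply (top_lim HF); intros eps Heps.
  destruct (Hg eps Heps) as [k [Hk Hw]].
  exact (ex_intro _ k (conj (IH k Hk) Hw)).
Qed.

Definition product_base (X Y : bishop_space) (k : bfun (bprod X Y) Rset) : Prop :=
  (exists f, top X f /\ feq k (bcomp f (bfst X Y))) \/
  (exists g, top Y g /\ feq k (bcomp g (bsnd X Y))).

Definition product_space (X Y : bishop_space) : bishop_space :=
  @BishopSpace (bprod X Y)
    (match space_inhabited X, space_inhabited Y with
     | inhabits x, inhabits y => inhabits (x, y)
     end)
    (generated_topology (@product_base X Y))
    (generated_topology_is_topology (@product_base X Y)).

Definition separating (X : bishop_space) : Prop :=
  forall x y : X, (forall f, top X f -> f x == f y) -> (x == y)%bset.

Definition closure (X : bishop_space) (H : X -> Prop) (x : X) : Prop :=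
  forall f, top X f -> CRealLtProp 0 (f x) ->
  exists v, H v /\ CRealLtProp 0 (f v).

Record bishop_topological_group := BishopTopologicalGroup {
  btg_space :> bishop_space;
  btg_add : bfun (bprod btg_space btg_space) btg_space;
  btg_zero : btg_space;
  btg_opp : bfun btg_space btg_space;
  btg_addA : forall x y z,
    (btg_add (x, btg_add (y, z)) == btg_add (btg_add (x, y), z))%bset;
  btg_add0l : forall x, (btg_add (btg_zero, x) == x)%bset;
  btg_add0r : forall x, (btg_add (x, btg_zero) == x)%bset;
  btg_addNl : forall x, (btg_add (btg_opp x, x) == btg_zero)%bset;
  btg_addNr : forall x, (btg_add (x, btg_opp x) == btg_zero)%bset;
  btg_add_morphism :
    @bishop_morphism (product_space btg_space btg_space) btg_space btg_add;
  btg_opp_morphism : @bishop_morphism btg_space btg_space btg_opp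
}.

Arguments btg_add {b}.
Arguments btg_zero : clear implicits.
Arguments btg_opp {b}.

Notation "x + y" := (btg_add (x, y)) : bset_scope.
Notation "- x" := (btg_opp x) : bset_scope.

Record subgroup (X : bishop_topological_group) (H : X -> Prop) : Prop := {
  subgroup_ext : forall x y, (x == y)%bset -> H x -> H y;
  subgroup_zero : H (btg_zero X);
  subgroup_add : forall x y, H x -> H y -> H (x + y)%bset;
  subgroup_opp : forall x, H x -> H (- x)%bset
}.

Definition abelian (X : bishop_topological_group) (H : X -> Prop) : Prop :=
  forall x y, H x -> H y -> (x + y == y + x)%bset.

Definition normal (X : bishop_topological_group) (H : X -> Prop) : Prop :=
  forall x h, H h -> H (x + h + - x)%bset.

(* Main.v *)
From Stdlib Require Import Ring Setoid Morphisms ConstructiveCauchyRealsMult.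
Require Import Defs.

Set Implicit Arguments.
Unset Strict Implicit.

(** Bishop morphisms are continuous for the closure operator: a morphism that
    sends [H] into [closure K] sends [closure H] into [closure K]
    ([closure_morphism]).  A map into a product is a morphism as soon as its two
    components are, so left and right translations, and hence conjugations, of a
    Bishop topological group are morphisms.

    Closedness under inverses and normality are then immediate.  For sums
    one works in one variable at a time: translating by [v] in [H] keeps
    [closure H] stable, so translating by [y] in [closure H] sends [H], and
    therefore [closure H], into [closure H].

    For commutativity, an inequality [f <= g] between functions of the topology
    extends from [H] to [closure H], because a point where [f - g] is positive
    could be moved into [H] ([le_on_closure]); hence so does an equality.  Applied
    to [f (x + y) = f (y + x)] in each variable in turn, this shows that no [f] of
    the topology tells [x + y] from [y + x]; a separating topology then
    identifies these two points.  All of this is constructive. *)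

Lemma bic_opp : exists phi : bfun Rset Rset,
  Bic phi /\ forall t : CReal, phi t = (- t)%CReal.
Proof.
assert (E : Proper (@beq Rset ==> @beq Rset) CReal_opp).
{ intros a b Hab; exact (CReal_opp_morph _ _ Hab). }
exists (@BFun Rset Rset CReal_opp E); split; [|reflexivity].
intros n _ N eps Heps; exists eps; split; [exact Heps|].
intros x y _ _ Hxy; simpl.
setoid_replace (- x - - y)%CReal with (- (x - y))%CReal by ring.
rewrite CReal_abs_opp; exact Hxy.
Qed.

Lemma top_diff (X : bset) (F : bfun X Rset -> Prop) (f g : bfun X Rset) :
  is_bishop_topology F -> F f -> F g ->
  exists k, F k /\ forall x, CRealEq (k x) (f x - g x)%CReal.
Proof.
intros HF Hf Hg; destruct bic_opp as [phi [Hphi E]].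
exists (bplus f (bcomp phi g)); split.
- exact (top_plus HF Hf (top_bic HF Hg Hphi)).
- intros x; simpl; rewrite E; reflexivity.
Qed.

(** * Bishop morphisms *)

Lemma morphism_id (X : bishop_space) (E : Proper (@beq X ==> @beq X) (fun x => x)) :
  @bishop_morphism X X (BFun E).
Proof.
intros g Hg; apply (top_ext (top_is_topology X) Hg); intros x; simpl; reflexivity.
Qed.

Lemma morphism_const (X Y : bishop_space) (y : Y)
    (E : Proper (@beq X ==> @beq Y) (fun _ => y)) :
  @bishop_morphism X Y (BFun E).
Proof.
intros g _; apply (top_ext (top_is_topology X) (top_const (top_is_topology X) (g y))).
intros x; simpl; reflexivity.
Qed.

Lemma morphism_comp (X Y Z : bishop_space) (g : bfun Y Z) (h : bfun X Y) :
  bishop_morphism g -> bishop_morphism h ->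
  @bishop_morphism X Z (bcomp g h).
Proof.
intros Hg Hh k Hk.
apply (top_ext (top_is_topology X) (Hh _ (Hg _ Hk))).
intros x; simpl; reflexivity.
Qed.

(** The inverse image of a topology is what makes the least topology containing
    a base comparable with the topology of the source of a map. *)
Lemma pullback_is_topology (X : bishop_space) (Y : bset) (h : bfun X Y) :
  is_bishop_topology (fun k : bfun Y Rset => top X (bcomp k h)).
Proof.
pose proof (top_is_topology X) as TX; split.
- intros f g Hf Hfg; apply (top_ext TX Hf); intros x; exact (Hfg (h x)).
- intros a; apply (top_ext TX (top_const TX a)); intros x; simpl; reflexivity.
- intros f g Hf Hg; apply (top_ext TX (top_plus TX Hf Hg)).
  intros x; simpl; reflexivity.
- intros f phi Hf Hphi; apply (top_ext TX (top_bic TX Hf Hphi)).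
  intros x; simpl; reflexivity.
- intros f Hf; apply (top_lim TX); intros eps Heps.
  destruct (Hf eps Heps) as [g [Hg Hw]].
  exists (bcomp g h); split; [exact Hg | intros x; exact (Hw (h x))].
Qed.

Program Definition bpair (Z X Y : bset) (a : bfun Z X) (b : bfun Z Y) :
    bfun Z (bprod X Y) :=
  @BFun Z (bprod X Y) (fun z => (a z, b z)) _.
Next Obligation.
intros z w H; split; [exact (bapp_ext a H) | exact (bapp_ext b H)].
Qed.

(** It suffices to test on the base of the product topology, since the functions
    that pull back into the topology of [Z] form a Bishop topology. *)
Lemma morphism_pair (Z X Y : bishop_space) (a : bfun Z X) (b : bfun Z Y) :
  bishop_morphism a -> bishop_morphism b ->
  @bishop_morphism Z (product_space X Y) (bpair a b).
Proof.
intros Ha Hb k Hk; pose proof (top_is_topology Z) as TZ.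
revert k Hk; apply generated_topology_least; [apply pullback_is_topology|].
intros k [[f [Hf E]] | [g [Hg E]]].
- apply (top_ext TZ (Ha f Hf)); intros z; symmetry; exact (E (a z, b z)).
- apply (top_ext TZ (Hb g Hg)); intros z; symmetry; exact (E (a z, b z)).
Qed.

Lemma translation_left_morphism (X : bishop_topological_group) (a : X) :
  exists h : bfun X X, bishop_morphism h /\ forall x, h x = (a + x)%bset.
Proof.
assert (Ec : Proper (@beq X ==> @beq X) (fun _ => a)).
{ intros x y _; reflexivity. }
assert (Ei : Proper (@beq X ==> @beq X) (fun x => x)).
{ intros x y Hxy; exact Hxy. }
exists (bcomp btg_add (bpair (BFun Ec) (BFun Ei))); split; [|reflexivity].
apply (@morphism_comp X (product_space X X) X); [apply btg_add_morphism|].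
apply morphism_pair; [apply morphism_const | apply morphism_id].
Qed.

Lemma translation_right_morphism (X : bishop_topological_group) (a : X) :
  exists h : bfun X X, bishop_morphism h /\ forall x, h x = (x + a)%bset.
Proof.
assert (Ec : Proper (@beq X ==> @beq X) (fun _ => a)).
{ intros x y _; reflexivity. }
assert (Ei : Proper (@beq X ==> @beq X) (fun x => x)).
{ intros x y Hxy; exact Hxy. }
exists (bcomp btg_add (bpair (BFun Ei) (BFun Ec))); split; [|reflexivity].
apply (@morphism_comp X (product_space X X) X); [apply btg_add_morphism|].
apply morphism_pair; [apply morphism_id | apply morphism_const].
Qed.

(** * Closure *)

Lemma subset_closure (X : bishop_space) (H : X -> Prop) x : H x -> closure H x.
Proof. intros Hx f _ Hf; exists x; split; assumption. Qed.

Lemma closure_ext (X : bishop_space) (H : X -> Prop) (x y : X) :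
  (x == y)%bset -> closure H x -> closure H y.
Proof.
intros E Hx f Hf Hpos; apply (Hx f Hf).
apply CRealLtForget; apply CRealLtEpsilon in Hpos.
pose proof (bapp_ext f E) as Ef; simpl in Ef.
exact (CReal_lt_le_trans _ _ _ Hpos (proj1 Ef)).
Qed.

(** A function [f] positive at [h x] pulls back along [h] to one positive at [x],
    hence at some [v] in [H]; then [f] is positive at [h v], which lies in
    [closure K].  Allowing [closure K] in the hypothesis builds in the
    idempotence of the closure. *)
Lemma closure_morphism (X Y : bishop_space) (h : bfun X Y)
    (H : X -> Prop) (K : Y -> Prop) :
  bishop_morphism h -> (forall v, H v -> closure K (h v)) ->
  forall x, closure H x -> closure K (h x).
Proof.
intros Hh HK x Hx f Hf Hpos.
destruct (Hx _ (Hh f Hf) Hpos) as [v [Hv Hfv]].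
exact (HK v Hv f Hf Hfv).
Qed.

(** The order [<=] on the reals is the negation of a strict inequality, so a
    failure at [x] is the positivity of [f - g] at [x], which would produce a
    failure inside [H]. *)
Lemma le_on_closure (X : bishop_space) (H : X -> Prop) (f g : bfun X Rset) :
  top X f -> top X g ->
  (forall v, H v -> f v <= g v)%CReal ->
  forall x, closure H x -> (f x <= g x)%CReal.
Proof.
intros Hf Hg Hle x Hx Hlt.
destruct (top_diff (top_is_topology X) Hf Hg) as [k [Hk Ek]].
destruct (Hx k Hk) as [v [Hv Hpos]].
- apply CRealLtForget; rewrite Ek.
  apply (CReal_plus_lt_reg_l (g x)); ring_simplify; exact Hlt.
- apply (Hle v Hv); apply CRealLtEpsilon in Hpos; rewrite Ek in Hpos.
  apply (CReal_plus_lt_compat_l (g v)) in Hpos; ring_simplify in Hpos.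
  exact Hpos.
Qed.

Lemma eq_on_closure (X : bishop_space) (H : X -> Prop) (f g : bfun X Rset) :
  top X f -> top X g ->
  (forall v, H v -> (f v == g v)%bset) ->
  forall x, closure H x -> (f x == g x)%bset.
Proof.
intros Hf Hg Heq x Hx; split.
- apply (le_on_closure Hg Hf (H := H)); [|exact Hx].
  intros v Hv; exact (proj1 (Heq v Hv)).
- apply (le_on_closure Hf Hg (H := H)); [|exact Hx].
  intros v Hv; exact (proj2 (Heq v Hv)).
Qed.

(** * Closures of subgroups *)

Section ClosureOfSubgroup.

Context (X : bishop_topological_group) (H : X -> Prop) (subH : subgroup H).

Lemma closure_add x y : closure H x -> closure H y -> closure H (x + y)%bset.
Proof.
intros Hx Hy.
destruct (translation_right_morphism y) as [r [Hr Er]]; rewrite <- Er.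
revert x Hx; apply closure_morphism; [exact Hr|]; intros v Hv; rewrite Er.
destruct (translation_left_morphism v) as [l [Hl El]]; rewrite <- El.
revert Hy; apply closure_morphism; [exact Hl|]; intros w Hw; rewrite El.
apply subset_closure, (subgroup_add subH); assumption.
Qed.

Lemma subgroup_closure : subgroup (closure H).
Proof.
split.
- intros x y; apply closure_ext.
- apply subset_closure, (subgroup_zero subH).
- exact closure_add.
- apply closure_morphism; [apply btg_opp_morphism|].
  intros v Hv; apply subset_closure, (subgroup_opp subH Hv).
Qed.

End ClosureOfSubgroup.

Lemma normal_closure (X : bishop_topological_group) (H : X -> Prop) :
  normal H -> normal (closure H).
Proof.
intros HN x h Hh.
destruct (translation_left_morphism x) as [l [Hl El]].
destruct (translation_right_morphism (- x)%bset) as [r [Hr Er]].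
rewrite <- El, <- Er.
apply (closure_morphism (morphism_comp Hr Hl) (H := H)); [|exact Hh].
intros v Hv; simpl; rewrite Er, El; apply subset_closure, HN, Hv.
Qed.

(** The variables are moved from [H] to its closure one at a time; the map
    [u |-> f (u + y)] is in the topology because translations are morphisms. *)
Lemma top_commute_closure (X : bishop_topological_group) (H : X -> Prop)
    (f : bfun X Rset) (y : X) :
  top X f ->
  (forall v, H v -> (f (v + y)%bset == f (y + v)%bset)%bset) ->
  forall x, closure H x -> (f (x + y)%bset == f (y + x)%bset)%bset.
Proof.
intros Hf Hv x Hx.
destruct (translation_left_morphism y) as [l [Hl El]].
destruct (translation_right_morphism y) as [r [Hr Er]].
rewrite <- El, <- Er.
apply (eq_on_closure (Hr f Hf) (Hl f Hf) (H := H)); [|exact Hx].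
intros v Hv'; simpl; rewrite El, Er; exact (Hv v Hv').
Qed.

Lemma abelian_closure (X : bishop_topological_group) (H : X -> Prop) :
  separating X -> abelian H -> abelian (closure H).
Proof.
intros HS HA x y Hx Hy; apply HS; intros f Hf.
apply (top_commute_closure Hf (H := H)); [|exact Hx].
intros v Hv; symmetry.
apply (top_commute_closure Hf (H := H)); [|exact Hy].
intros w Hw; exact (bapp_ext f (HA w v Hw Hv)).
Qed.

Theorem theorem5p6 (X : bishop_topological_group) (H : X -> Prop)
    (subH : subgroup H) :
  subgroup (closure H) /\
  (separating X -> abelian H -> abelian (closure H)) /\
  (normal H -> normal (closure H)).
Proof.
split; [|split].
- exact (subgroup_closure subH).
- apply abelian_closure.
- apply normal_closure.
Qed.
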